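(* Let $C$ be a normal cone with nonempty interior in a real Banach space $(X,\|\cdot\|)$, and let $G$ be an open subset of $(X,\|\cdot\|)$ included in $C$. Assume that $f:G\to G$ is nonexpansive with respect to Thompson's metric $\bar d$ (i.e. $\bar d(f(x),f(y))\le\bar d(x,y)$ for all $x,y\in G$). If $f$ has a fixed point $v\in G$, and if $f$ is semidifferentiable at $v$ with $\tilde r(f'_v)<1$, where $\tilde r$ is Bonsall's spectral radius defined with respect to the norm $\|\cdot\|$ or the norm $\|\cdot\|_v$, then the fixed point of $f$ in $G$ is unique. Moreover, if $G$ is connected, we have $$\limsup_{k\to\infty}\bar d(f^k(x),v)^{1/k}\le\tilde r(f'_v)\qquad\text{for all }x\in G.$$
   Context: Cones: a subset $C\subset X$ is a cone if $tC\subset C$ for all $t\ge0$. It is proper if it is closed, convex and pointed ($C\cap(-C)=\{0\}$); it then defines the partial order $x\le y\iff y-x\in C$. It is normal if it is proper and there is a constant $M$ with $\|x\|\le M\|y\|$ whenever $0\le x\le y$. For $v\in\operatorname{int}C$, $\|x\|_v=\inf\{a>0\mid -av\le x\le av\}$, a norm on $X$. Thompson's metric: for $x,y\in\operatorname{int}C$, let $M(y/x)=\inf\{b\in\mathbb R\mid y\le bx\}$ and $m(y/x)=\sup\{a\in\mathbb R\mid ax\le y\}$; then $\bar d(x,y)=\max(\log M(y/x),-\log m(y/x))$. Semidifferentiability: let $G\subset X$ and $v$ an interior point of $G$. A map $f:G\to X$ is semidifferentiable at $v$ if there exists a continuous, positively homogeneous map $h:X\to X$ (i.e. $h(tx)=th(x)$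 for all $t>0$, $x\in X$) such that $f(v+x)=f(v)+h(x)+o(\|x\|)$ as $x\to0$. Such $h$ is unique and denoted $f'_v$ (the semidifferential of $f$ at $v$). Bonsall's spectral radius: for a continuous positively homogeneous self-map $h$ of a normed space, put $\|h\|=\sup_{x\ne0}\|h(x)\|/\|x\|<\infty$ and $\tilde r(h)=\lim_{k\to\infty}\|h^k\|^{1/k}=\inf_{k\ge1}\|h^k\|^{1/k}$, where $h^k$ is the $k$-th iterate. Similarly $f^k$ is the $k$-th iterate of $f$. *)

(* Defs.v *)
From HB Require Import structures.
From mathcomp Require Import all_boot all_order all_algebra.
From mathcomp Require Import all_classical all_reals all_analysis.
Export numFieldNormedType.Exports.

Set Implicit Arguments.
Unset Strict Implicit.
Unset Printing Implicit Defensive.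

Import Order.TTheory GRing.Theory Num.Theory.

Local Open Scope classical_set_scope.
Local Open Scope ring_scope.

Section cones.
Context {R : realType} {X : normedModType R}.
Implicit Types (C : set X) (x y v : X).

Definition is_cone C := forall (t : R) x, 0 <= t -> C x -> C (t *: x).

Definition proper_cone C :=
  [/\ is_cone C, closed C, convex_set C & C `&` (-%R @` C) = [set 0]].

Definition cone_le C x y := C (y - x).

Definition normal_cone C :=
  proper_cone C /\
  exists M : R, forall x y, cone_le C 0 x -> cone_le C x y ->
    `|x| <= M * `|y|.

Definition cone_norm C v x : R :=
  inf [set a : R | [/\ 0 < a, cone_le C (- a *: v) x & cone_le C x (a *: v)]].

(* For x and y in the interior of a proper cone, the sets below are nonempty
   and bounded on the relevant side, and the values are positive, except when
   X is the null space, where thompson C 0 0 = 0 by the default values of inf,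
   sup and ln. *)
Definition cone_Mratio C y x : R := inf [set b : R | cone_le C y (b *: x)].

Definition cone_mratio C y x : R := sup [set a : R | cone_le C (a *: x) y].

Definition thompson C x y : R :=
  Num.max (ln (cone_Mratio C y x)) (- ln (cone_mratio C y x)).

End cones.

Section semidifferentials.
Context {R : realType} {X : normedModType R}.
Implicit Types (G : set X) (f h : X -> X) (v : X) (N : X -> R).

Definition pos_homogeneous h := forall (t : R) x, 0 < t -> h (t *: x) = t *: h x.

(* A map f : G -> X is represented by a total function. As v is interior to G,
   only the values of f on G matter here. There is at most one such h. *)
Definition is_semidiff G f v h :=
  [/\ G° v, continuous h, pos_homogeneous h &
      (fun x => f (v + x) - (f v + h x)) =o_ (0 : X) id].

(* N is the norm of X with respect to which the radius is taken. When N is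
   equivalent to the norm of X and h is continuous and positively homogeneous,
   the supremum is finite and the limit exists. *)
Definition homog_norm N h : R := sup [set N (h x) / N x | x in [set x | x != 0]].

Definition bonsall_radius N h : R :=
  limn (fun k => homog_norm N (iter k h) `^ (k%:R^-1)).

End semidifferentials.

(* Main.v *)
Require Import Defs.
From mathcomp Require Import all_boot all_order all_algebra.
From mathcomp Require Import all_classical all_reals all_analysis.
From mathcomp Require Import ring lra.

Import Order.TTheory GRing.Theory Num.Theory.

Local Open Scope classical_set_scope.
Local Open Scope ring_scope.

(* Near [v] Thompson's metric is comparable with the norm, so [f] is locally
   Lipschitz and [f^k] has the first order expansion [v + h^k x + o(|x|)] at
   [v].  For [r(h) < c < 1] and [m] large, [f^m] is thus a [c^m]-contraction
   towards [v] on a small ball, and nonexpansiveness fills in the iterates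
   between multiples of [m].

   Uniqueness: if [w <> v] is fixed, then [x = (1 - t) v + t w] with [t] small
   is attracted to [v] but is strictly closer to [w] than [v] is, while its
   orbit never moves away from [w].

   Rate: nonexpansiveness makes the basin of attraction of [v] both open and
   closed in [G], so it is [G] when [G] is connected, and every orbit
   eventually enters the small ball. *)

(** * Room around interior points *)

Section interior_points.
Context {R : realType} {X : normedModType R}.
Implicit Types (C : set X) (x y z v : X).

Lemma interior_closed_ball C x : C° x ->
  exists2 r : R, 0 < r & forall z, `|z| <= r -> C (x + z).
Proof.
move=> /nbhs_ballP[e /= e0 Ce]; exists (e / 2); first by rewrite divr_gt0.
move=> z zle; apply: Ce; rewrite -ball_normE /= opprD addrA subrr sub0r normrN.
by rewrite (le_lt_trans zle)// ltr_pdivrMr// ltr_pMr// ltr1n.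
Qed.

Lemma interior_absorbs C x y : C° x ->
  exists2 t : R, 0 < t & C (x + t *: y).
Proof.
move=> /interior_closed_ball[r r0 Cr].
have y0 : 0 < `|y| + 1 by rewrite ltr_wpDl.
exists (r / (`|y| + 1)); first by rewrite divr_gt0.
apply: Cr; rewrite normrZ ger0_norm; last by rewrite ltW ?divr_gt0.
by rewrite mulrAC ler_pdivrMr// ler_pM2l// lerDl.
Qed.

End interior_points.

(** * The order of a proper cone and Thompson's metric *)

Section proper_cones.
Context {R : realType} {X : normedModType R}.
Context (C : set X) (C_proper : proper_cone C).
Implicit Types (x y z v : X) (a b : R).

Lemma coneZ t x : 0 <= t -> C x -> C (t *: x).
Proof. by case: C_proper => + _ _ _; apply. Qed.

Lemma coneD x y : C x -> C y -> C (x + y).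
Proof.
move=> Cx Cy; case: C_proper => _ _ Cconv _.
have h0 : (0 : R) <= 2^-1 by lra.
have h1 : (2^-1 : R) <= 1 by lra.
have /set_mem := Cconv x y (Itv01 h0 h1)
   (mem_set Cx) (mem_set Cy).
move=> /(coneZ 2 _ (ler0n _ _)).
rewrite /conv /= /unstable.onem scalerDr !scalerA.
have -> : 2 * (2^-1 : R) = 1 by field.
have -> : 2 * (1 - 2^-1 : R) = 1 by field.
by rewrite !scale1r.
Qed.

Lemma cone0 : C 0.
Proof.
case: C_proper => _ _ _ C0; have : [set 0] (0 : X) by [].
by rewrite -C0 => -[].
Qed.

Lemma cone_pointed x : C x -> C (- x) -> x = 0.
Proof.
case: C_proper => _ _ _ C0 Cx Cnx.
have : (C `&` (-%R @` C)) x by split => //; exists (- x) => //; rewrite opprK.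
by rewrite C0.
Qed.

Lemma coneZ_ge0 a x : C x -> x != 0 -> C (a *: x) -> 0 <= a.
Proof.
move=> Cx x0 Cax; rewrite leNgt; apply/negP => a0; move/eqP: x0; apply.
apply: cone_pointed => //; rewrite -scaleN1r.
have -> : -1 = (- a)^-1 * a by rewrite invrN mulNr mulVf// lt_eqF.
by rewrite -scalerA; apply: coneZ => //; rewrite invr_ge0 oppr_ge0 ltW.
Qed.

Lemma cone_limit x z : (forall e, 0 < e -> C (z + e *: x)) -> C z.
Proof.
move=> Ce; case: C_proper => _ Ccl _ _; apply: Ccl => B /nbhs_ballP[r /= r0 rB].
have x0 : 0 < `|x| + 1 by rewrite ltr_wpDl.
exists (z + (r / (`|x| + 1)) *: x); split; first by apply: Ce; rewrite divr_gt0.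
apply: rB; rewrite -ball_normE /= opprD addrA subrr sub0r normrN normrZ.
rewrite gtr0_norm ?divr_gt0//.
by rewrite mulrAC ltr_pdivrMr// ltr_pM2l// ltrDl.
Qed.

(** The bound [thompson C x y <= ln b], for interior points and [b >= 1], in logarithm-free form. *)
Definition thompson_within b x y := C (b *: x - y) /\ C (b *: y - x).

Lemma thompson_withinC b x y : thompson_within b x y -> thompson_within b y x.
Proof. by case. Qed.

Lemma thompson_within_refl x : thompson_within 1 x x.
Proof.
by split; rewrite scale1r subrr; exact: cone0.
Qed.

Lemma thompson_within_le b b' x y : C x -> C y -> b <= b' ->
  thompson_within b x y -> thompson_within b' x y.
Proof.
move=> Cx Cy bb' [xy yx].
have aux z z' : C z -> C (b *: z - z') -> C (b' *: z - z').
  move=> Cz Czz'; rewrite -(subrK b b') scalerDl -addrA.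
  by apply: coneD => //; apply: coneZ => //; rewrite subr_ge0.
by split; apply: aux.
Qed.

Lemma thompson_within_trans b c x y z : 0 <= b -> 0 <= c ->
  thompson_within b x y -> thompson_within c y z -> thompson_within (b * c) x z.
Proof.
move=> b0 c0 [xy yx] [yz zy]; split.
- have -> : (b * c) *: x - z = c *: (b *: x - y) + (c *: y - z).
    by rewrite scalerBr scalerA mulrC addrA subrK.
  by apply: coneD => //; apply: coneZ.
- have -> : (b * c) *: z - x = b *: (c *: z - y) + (b *: y - x).
    by rewrite scalerBr scalerA addrA subrK.
  by apply: coneD => //; apply: coneZ.
Qed.

(** A cone with 0 in its interior absorbs every vector, so it is the whole space, and pointedness
    then leaves only the null space. This settles the cases [x = 0] below. *)
Lemma interior0 : C° 0 -> forall x, x = 0.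
Proof.
move=> C0 x.
have CT y : C y.
  have [t t0] := interior_absorbs C 0 y C0; rewrite add0r => Cty.
  by rewrite -(scale1r y) -(mulVf (lt0r_neq0 t0)) -scalerA; apply: coneZ => //;
    rewrite invr_ge0 ltW.
exact: cone_pointed.
Qed.

Lemma cone_dominates x y : C° x -> exists2 b, 0 < b & C (b *: x - y).
Proof.
move=> /(interior_absorbs C x (- y))[t t0 Ct]; exists t^-1; first
  by rewrite invr_gt0.
have -> : t^-1 *: x - y = t^-1 *: (x + t *: - y).
  by rewrite scalerDr scalerA mulVf ?scale1r// lt0r_neq0.
by apply: coneZ => //; rewrite invr_ge0 ltW.
Qed.

Lemma interior_cone x : C° x -> C x.
Proof. exact: interior_subset. Qed.

(* The optimal ratios are attained because [C] is closed. *)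
Lemma cone_ratios x y : C° x -> C° y -> x != 0 ->
  [/\ 0 < cone_mratio C y x, cone_mratio C y x <= cone_Mratio C y x,
      (forall b, cone_Mratio C y x <= b <-> C (b *: x - y)) &
      (forall a, a <= cone_mratio C y x <-> C (y - a *: x))].
Proof.
move=> Cx Cy x0.
have [B B0 CB] := cone_dominates x y Cx.
have [e0 e00 Ce0] := interior_absorbs C y (- x) Cy.
have {Ce0} Ce0 : C (y - e0 *: x) by rewrite scalerN in Ce0.
(* Adding the two memberships puts [(b - a) *: x] in [C]. This bounds both sets of ratios, so [inf]
   and [sup] are genuine. *)
have order a b : C (y - a *: x) -> C (b *: x - y) -> a <= b.
  move=> Ca Cb; rewrite -subr_ge0; apply: (coneZ_ge0 _ x) => //.
    exact: interior_cone.
  by have := coneD _ _ Cb Ca; rewrite addrA subrK -scalerBl.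
have Mlb b : C (b *: x - y) -> cone_Mratio C y x <= b.
  by move=> Cb; apply: ge_inf => //; exists e0 => a /= Ca; exact: order.
have mub a : C (y - a *: x) -> a <= cone_mratio C y x.
  by move=> Ca; apply: ub_le_sup => //; exists B => b /= Cb; exact: order.
(* Replacing the infimum by a ratio [b] less than [e] above it costs a multiple of [x] that lies in
   [C]; then [e] tends to 0. *)
have CM : C (cone_Mratio C y x *: x - y).
  apply: (cone_limit x) => e e_gt0.
  have [|b /= Cb bM] := @inf_adherent _ [set b | cone_le C y (b *: x)] _ e_gt0.
    by split; [exists B | exists e0 => a /= Ca; exact: order].
  have -> : cone_Mratio C y x *: x - y + e *: x =
      (cone_Mratio C y x + e - b) *: x + (b *: x - y).
    by rewrite addrAC -scalerDl addrA -scalerDl subrK.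
  apply: coneD => //; apply: coneZ; last exact: interior_cone.
  by rewrite subr_ge0 ltW.
have Cm : C (y - cone_mratio C y x *: x).
  apply: (cone_limit x) => e e_gt0.
  have [|a /= Ca am] := @sup_adherent _ [set a | cone_le C (a *: x) y] _ e_gt0.
    by split; [exists e0 | exists B => a /= Ca; exact: order].
  have -> : y - cone_mratio C y x *: x + e *: x =
      (a - (cone_mratio C y x - e)) *: x + (y - a *: x).
    by rewrite !scalerBl [RHS]addrC addrA subrK opprB -addrA (addrC _ (e *: x)).
  apply: coneD => //; apply: coneZ; last exact: interior_cone.
  by rewrite subr_ge0 ltW.
split.
- exact: lt_le_trans (mub _ Ce0).
- exact: order.
- move=> b; split; last exact: Mlb.
  move=> Mb; have -> : b *: x - y = (b - cone_Mratio C y x) *: x + (cone_Mratio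
    C y x *: x - y).
    by rewrite addrA -scalerDl subrK.
  by apply: coneD => //; apply: coneZ; [rewrite subr_ge0|exact: interior_cone].
- move=> a; split; last exact: mub.
  move=> am; have -> : y - a *: x = (cone_mratio C y x - a) *: x + (y -
    cone_mratio C y x *: x).
    by rewrite scalerBl [RHS]addrC addrA subrK.
  by apply: coneD => //; apply: coneZ; [rewrite subr_ge0|exact: interior_cone].
Qed.

(** Both sets of ratios are all of [R], so [inf] and [sup] take the default value 0, and so does
    [ln] at 0. *)
Lemma thompson_null_space : (forall z : X, z = 0) -> forall x y, thompson C x y
  = 0.
Proof.
move=> X0 x y.
have C0 z : C z by rewrite (X0 z); exact: cone0.
rewrite /thompson /cone_Mratio /cone_mratio.
have -> : [set b : R | cone_le C y (b *: x)] = setT.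
  by apply/seteqP; split=> // b _; exact: C0.
have -> : [set a : R | cone_le C (a *: x) y] = setT.
  by apply/seteqP; split=> // a _; exact: C0.
rewrite inf_out; last first.
  by move=> [_ [M MP]]; have := MP (M - 1) I; rewrite lerBrDr gerDl leNgt ltr01.
rewrite sup_out; last first.
  by move=> [_ [M MP]]; have := MP (M + 1) I; rewrite gerDl leNgt ltr01.
by rewrite ln0// oppr0 maxxx.
Qed.

Lemma thompson_ge0 x y : C° x -> C° y -> 0 <= thompson C x y.
Proof.
move=> Cx Cy; have [x0|x0] := eqVneq x 0.
  by rewrite thompson_null_space//; apply: interior0; rewrite -x0.
have [m0 mM _ _] := cone_ratios _ _ Cx Cy x0.
rewrite /thompson le_max oppr_ge0; have [m1|m1] := leP (cone_mratio C y x) 1.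
  by rewrite (ln_le0 m1) orbT.
by rewrite ln_ge0// (le_trans (ltW m1)).
Qed.

(** Since the optimal ratios are attained, the bound says [y <= b x] and [b^-1 x <= y]; scaling the
    second gives [x <= b y]. *)
Lemma thompson_leP x y b : C° x -> C° y -> 1 <= b ->
  thompson C x y <= ln b <-> thompson_within b x y.
Proof.
move=> Cx Cy b1; have [x0|x0] := eqVneq x 0.
  have X0 : forall z : X, z = 0 by apply: interior0; rewrite -x0.
  rewrite thompson_null_space// ln_ge0//; split=> // _.
  by split; rewrite (X0 (_ - _)) -x0; exact: interior_cone.
have [m0 mM MP mP] := cone_ratios _ _ Cx Cy x0.
have b0 : 0 < b by exact: lt_le_trans b1.
have M0 : 0 < cone_Mratio C y x by exact: lt_le_trans mM.
rewrite /thompson ge_max lerNl -lnV ?posrE// !ler_ln ?posrE ?invr_gt0//.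
have yx : C (b *: y - x) <-> C (y - b^-1 *: x).
  split=> [/(coneZ b^-1)|/(coneZ b)].
    rewrite scalerBr scalerA mulVf ?scale1r ?lt0r_neq0//; apply.
    by rewrite invr_ge0 ltW.
  by rewrite scalerBr scalerA mulfV ?scale1r ?lt0r_neq0//; apply; exact: ltW.
split=> [/andP[/MP Cb /mP/yx Cb']|[/MP Mb /yx/mP mb]]; first by [].
by apply/andP.
Qed.

End proper_cones.

(** * Growth of submultiplicative sequences *)

Section submultiplicative.
Context {R : realType}.
Implicit Types (a : nat -> R) (b c : R).

Lemma powR_inv_le (x b : R) n : (0 < n)%N -> 0 <= x -> 0 <= b ->
  x `^ n%:R^-1 <= b <-> x <= b ^+ n.
Proof.
move=> n0 x0 b0; have nR : n%:R != 0 :> R by rewrite pnatr_eq0 -lt0n.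
split=> [xb|xb].
  have -> : x = (x `^ n%:R^-1) ^+ n.
    by rewrite -powR_mulrn ?powR_ge0// -powRrM mulVf// powRr1.
  by rewrite lerXn2r// nnegrE powR_ge0.
have -> : b = (b ^+ n) `^ n%:R^-1.
  by rewrite -powR_mulrn// -powRrM mulfV// powRr1.
by rewrite ge0_ler_powR// ?nnegrE ?exprn_ge0// invr_ge0 ler0n.
Qed.

(** The strict gap between the rates absorbs any constant, because [(c / c') ^+ n] tends to 0. *)
Lemma geometric_dominated b c c' : 0 < c -> c < c' ->
  \forall n \near \oo, b * c ^+ n <= c' ^+ n.
Proof.
move=> c0 cc'; have c'0 : 0 < c' by exact: lt_trans cc'.
have q1 : `|c / c'| < 1.
  by rewrite gtr0_norm ?divr_gt0// ltr_pdivrMr// mul1r.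
have b0 : 0 < `|b| + 1 by rewrite ltr_wpDl.
have e0 : 0 < (`|b| + 1)^-1 by rewrite invr_gt0.
have ev := cvgr0_norm_lt _ (cvg_expr q1) _ e0.
near=> n; have : `|(c / c') ^+ n| < (`|b| + 1)^-1 by near: n; exact: ev.
rewrite normrX gtr0_norm ?divr_gt0// expr_div_n.
rewrite ltr_pdivrMr ?exprn_gt0// mulrC ltr_pdivlMr// => h.
apply: le_trans (ltW h); rewrite mulrC ler_pM2l ?exprn_gt0//.
by rewrite (le_trans (ler_norm b))// lerDl.
Unshelve. all: by end_near. Qed.

(** With [n = q m + s] and [s < m], the [q] full blocks contribute [c ^+ (q * m)], and only finitely
    many remainders [s] are left to bound. *)
Lemma submultiplicative_growth a m c :
  (forall k, 0 <= a k) -> (forall i j, a (i + j)%N <= a i * a j) ->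
  (0 < m)%N -> 0 < c -> a m <= c ^+ m ->
  exists b, forall n, a n <= b * c ^+ n.
Proof.
move=> a0 aM m0 c0 amc.
(* [K] bounds the growth in one step and [A] covers [a 0]. Taking [K] at least [c] makes
   [(K / c) ^+ s] nondecreasing in [s], hence at most [(K / c) ^+ m]. *)
set K := Num.max (a 1%N) c; set A := 1 + a 0%N.
have K0 : 0 < K by rewrite lt_max c0 orbT.
have A0 : 0 < A by rewrite ltr_pwDl.
have aK s : a s <= A * K ^+ s.
  elim: s => [|s IH]; first by rewrite expr0 mulr1 lerDr.
  apply: le_trans (aM 1%N s) _; rewrite exprS mulrCA.
  by rewrite ler_pM// le_max lexx.
have aq q s : a (q * m + s)%N <= c ^+ (q * m) * a s.
  elim: q => [|q IH]; first by rewrite mul0n expr0 mul1r.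
  rewrite mulSn -addnA exprD -mulrA; apply: le_trans (aM _ _) _.
  by rewrite ler_pM.
have Kc : 1 <= K / c by rewrite ler_pdivlMr// mul1r le_max lexx orbT.
have as_le s : (s < m)%N -> a s <= A * (K / c) ^+ m * c ^+ s.
  move=> sm; apply: le_trans (aK s) _.
  rewrite -mulrA ler_pM2l// -ler_pdivrMr ?exprn_gt0// -expr_div_n.
  by rewrite ler_weXn2l// ltnW.
exists (A * (K / c) ^+ m) => n.
rewrite (divn_eq n m) exprD mulrCA; apply: le_trans (aq _ _) _.
by rewrite ler_pM2l ?exprn_gt0// as_le// ltn_mod.
Qed.

(* Fekete's lemma, in multiplicative form. *)
Lemma submultiplicative_root_cvg a :
  (forall k, 0 <= a k) -> (forall i j, a (i + j)%N <= a i * a j) ->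
  cvgn (fun k => a k `^ k%:R^-1).
Proof.
move=> a0 aM.
(* Index 0 is left out: [0%:R^-1] is 0, so the root there is always 1. *)
set S := [set a k `^ k%:R^-1 | k in [set k | (0 < k)%N]].
have Slb : has_lbound S by exists 0 => _ [k _ <-]; exact: powR_ge0.
have S0 : S !=set0 by exists (a 1%N `^ 1%:R^-1); exists 1%N.
have r0 : 0 <= inf S by apply: lb_le_inf => // _ [k _ <-]; exact: powR_ge0.
apply/cvg_ex; exists (inf S); apply/cvgrPdist_le => e e0.
have e2 : 0 < e / 2 by rewrite divr_gt0.
(* An index [m] whose root is within [e / 2] of the infimum fixes the rate; the other [e / 2]
   absorbs the constant [b]. *)
have [_ [m /= m0 <-] /ltW] := inf_adherent e2 (conj S0 Slb).
have c0 : 0 < inf S + e / 2 by rewrite ltr_wpDl.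
move=> /(powR_inv_le _ _ _ m0 (a0 m) (ltW c0)) amc.
have [b ab] := submultiplicative_growth _ _ _ a0 aM m0 c0 amc.
have cc' : inf S + e / 2 < inf S + e
  by rewrite ltrD2l ltr_pdivrMr// ltr_pMr// ltr1n.
have := geometric_dominated b _ _ c0 cc'; move=> abc.
near=> n; have n0 : (0 < n)%N by near: n; exact: nbhs_infty_gt.
have rn : inf S <= a n `^ n%:R^-1 by apply: ge_inf => //; exists n.
rewrite distrC ger0_norm ?subr_ge0// lerBlDl.
apply/powR_inv_le => //; first by rewrite addr_ge0// ltW.
apply: le_trans (ab n) _; near: n; exact: abc.
Unshelve. all: by end_near. Qed.

End submultiplicative.

(** * Bonsall's radius in an equivalent norm *)

Section bonsall.
Context {R : realType} {X : normedModType R}.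
Context (N : X -> R) (c1 c2 : R).
Context (c1_gt0 : 0 < c1) (N_equiv : forall x, c1 * `|x| <= N x <= c2 * `|x|).
Implicit Types (g h : X -> X) (x : X) (L : R).

Lemma equiv_norm_ge0 x : 0 <= N x.
Proof. by have /andP[+ _] := N_equiv x; apply: le_trans; rewrite mulr_ge0//
  ltW. Qed.

Lemma equiv_norm_gt0 x : x != 0 -> 0 < N x.
Proof.
move=> x0; have /andP[+ _] := N_equiv x; apply: lt_le_trans.
by rewrite mulr_gt0// normr_gt0.
Qed.

Lemma equiv_norm0 : N 0 = 0.
Proof.
have := N_equiv 0; rewrite normr0 !mulr0 => /andP[? ?].
by apply/eqP; rewrite eq_le; apply/andP.
Qed.

Lemma homog_norm_ge0 g : 0 <= homog_norm N g.
Proof.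
have [[[_ [x x0 _]] ub]|nsup] :=
    pselect (has_sup [set N (g x) / N x | x in [set x | x != 0]]).
  apply: le_trans (ub_le_sup ub _); last by exists x.
  by rewrite divr_ge0// equiv_norm_ge0.
by rewrite /homog_norm sup_out.
Qed.

Lemma homog_norm_bound g L : 0 <= L -> (forall x, `|g x| <= L * `|x|) ->
  forall x, N (g x) <= homog_norm N g * N x.
Proof.
move=> L0 gL x; have [->|x0] := eqVneq x 0.
  have -> : g 0 = 0 by apply/normr0_eq0/le_anti; rewrite normr_ge0 andbT; have
    := gL 0; rewrite normr0 mulr0.
  by rewrite equiv_norm0 mulr0.
have Nx := equiv_norm_gt0 x x0.
rewrite -ler_pdivrMr//; apply: ub_le_sup; last by exists x.
(* Equivalence gives [N (g y) <= c2 * L * |y| <= (c2 * L / c1) * N y], so the ratios are bounded and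
   the supremum is a true one. *)
exists (c2 * L / c1) => _ [y /= y0 <-].
have Ny := equiv_norm_gt0 y y0.
rewrite ler_pdivrMr// mulrAC ler_pdivlMr//.
have c20 : 0 <= c2.
  have /andP[h1 h2] := N_equiv x.
  by have := lt_le_trans Nx h2; rewrite pmulr_lgt0 ?normr_gt0// => /ltW.
have /andP[h1 _] := N_equiv y; have /andP[_ h2] := N_equiv (g y).
have h3 := gL y.
apply: le_trans (ler_wpM2r (ltW c1_gt0) h2) _.
rewrite -!mulrA ler_wpM2l//.
apply: le_trans (ler_wpM2r (ltW c1_gt0) h3) _.
by rewrite -mulrA ler_wpM2l// mulrC.
Qed.

Lemma homog_norm_comp g1 g2 L1 L2 : 0 <= L1 -> 0 <= L2 ->
  (forall x, `|g1 x| <= L1 * `|x|) -> (forall x, `|g2 x| <= L2 * `|x|) ->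
  homog_norm N (g1 \o g2) <= homog_norm N g1 * homog_norm N g2.
Proof.
move=> L10 L20 g1L g2L.
have [[y [x x0 _]]|/set0P/negP] := pselect ([set N ((g1 \o g2) x) / N x | x in
  [set x | x != 0]] !=set0).
  apply: ge_sup; first by exists (N ((g1 \o g2) x) / N x), x.
  move=> _ [z /= z0 <-]; rewrite ler_pdivrMr ?equiv_norm_gt0//.
  apply: le_trans (homog_norm_bound _ _ L10 g1L _) _.
  by rewrite -mulrA ler_wpM2l ?homog_norm_ge0//; exact: homog_norm_bound g2L _.
(* There is no nonzero vector here, and the supremum of the empty set is 0. *)
move=> /negPn/eqP S0; rewrite {1}/homog_norm S0 sup0.
by rewrite mulr_ge0// homog_norm_ge0.
Qed.

Context (h : X -> X) (K : R) (K_ge0 : 0 <= K) (hK : forall x, `|h x| <= K *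
  `|x|).

Lemma iter_bound k x : `|iter k h x| <= K ^+ k * `|x|.
Proof.
elim: k => [|k IH] /=; first by rewrite expr0 mul1r.
by rewrite exprS -mulrA (le_trans (hK _))// ler_wpM2l.
Qed.

Lemma homog_norm_iterD i j :
  homog_norm N (iter (i + j) h) <= homog_norm N (iter i h) * homog_norm N (iter
    j h).
Proof.
have -> : iter (i + j) h = iter i h \o iter j h
  by apply/funext => x; rewrite iterD.
by apply: (homog_norm_comp _ _ (K ^+ i) (K ^+ j));
  rewrite ?exprn_ge0// => x; exact: iter_bound.
Qed.

Lemma bonsall_radius_ge0 : 0 <= bonsall_radius N h.
Proof.
apply: limr_ge; last by apply: nearW => k; exact: powR_ge0.
apply: (submultiplicative_root_cvg (fun k => homog_norm N (iter k h))).
  by move=> k; exact: homog_norm_ge0.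
exact: homog_norm_iterD.
Qed.

(** Passing from [N] back to the norm of [X] costs the factor [c2 / c1], absorbed by the gap between
    an intermediate rate [d] and [c]. Both norms of the theorem thus yield the same estimate. *)
Lemma bonsall_radius_iter c : bonsall_radius N h < c ->
  \forall k \near \oo, forall x, `|iter k h x| <= c ^+ k * `|x|.
Proof.
move=> rc; have r0 := bonsall_radius_ge0.
set d := (bonsall_radius N h + c) / 2.
have [rd dc] : bonsall_radius N h < d /\ d < c by rewrite /d; split; lra.
have d0 : 0 < d by exact: le_lt_trans rd.
have cv : cvgn (fun k => homog_norm N (iter k h) `^ k%:R^-1).
  apply: (submultiplicative_root_cvg (fun k => homog_norm N (iter k h))).
    by move=> k; exact: homog_norm_ge0.
  exact: homog_norm_iterD.
have ev1 := cvgr_lt _ cv d rd.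
have ev2 := geometric_dominated (c2 / c1) _ _ d0 dc.
near=> k => x; have k0 : (0 < k)%N by near: k; exact: nbhs_infty_gt.
have ak : homog_norm N (iter k h) <= d ^+ k.
  by apply/powR_inv_le; rewrite ?homog_norm_ge0 ?ltW//; near: k; exact: ev1.
have /andP[h1 _] := N_equiv (iter k h x); have /andP[h2 h3] := N_equiv x.
rewrite -(ler_pM2l c1_gt0); apply: le_trans h1 _.
apply: le_trans (homog_norm_bound _ (K ^+ k) _ _ _) _; rewrite ?exprn_ge0//.
  by move=> y; exact: iter_bound.
apply: le_trans (ler_wpM2r (equiv_norm_ge0 x) ak) _.
apply: le_trans (ler_wpM2l _ h3) _; first by rewrite exprn_ge0// ltW.
have e : c2 / c1 * d ^+ k <= c ^+ k by near: k; exact: ev2.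
rewrite !mulrA ler_wpM2r// mulrC; apply: le_trans (ler_wpM2l (ltW c1_gt0) e).
by rewrite mulrA (mulrC c1) mulfVK// lt0r_neq0.
Unshelve. all: by end_near. Qed.

End bonsall.

(** * First-order expansion of the iterates *)

Section first_order.
Context {R : realType} {X : normedModType R}.
Implicit Types (f h : X -> X) (v x : X).

Lemma near0_norm_le (d : R) : 0 < d -> \forall x \near (0 : X), `|x| <= d.
Proof.
move=> d0; apply/nbhs_normP; exists d => // x /=; rewrite sub0r normrN => /ltW.
exact.
Qed.

Lemma near0_norm_leP (P : X -> Prop) : (\forall x \near (0 : X), P x) ->
  exists2 d : R, 0 < d & forall x, `|x| <= d -> P x.
Proof.
move=> /nbhs_normP[e /= e0 eP]; exists (e / 2); first by rewrite divr_gt0.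
move=> x xe; apply: eP => /=; rewrite sub0r normrN.
by rewrite (le_lt_trans xe)// ltr_pdivrMr// ltr_pMr// ltr1n.
Qed.

(** Continuity at 0 bounds [h] on a small ball, and positive homogeneity spreads the bound to the
    whole space. *)
Lemma pos_homogeneous_bound h : continuous h -> pos_homogeneous h ->
  exists2 K : R, 0 <= K & forall x, `|h x| <= K * `|x|.
Proof.
move=> hc hh.
(* Homogeneity concerns positive factors only, so this comes from [h 0 = 2 h 0]. *)
have h0 : h 0 = 0.
  have := hh 2 0 (ltr0n _ 2); rewrite scaler0 => /eqP.
  by rewrite scaler_nat mulr2n -subr_eq0 opprD addrA subrr sub0r oppr_eq0 =>
    /eqP.
have h_near : \forall x \near (0 : X), `|h x| <= 1.
  have hc0 := hc 0; rewrite /continuous_at h0 in hc0.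
  by near=> x; apply: ltW; near: x; exact: cvgr0_norm_lt hc0 _ ltr01.
have [d d0 dP] := near0_norm_leP _ h_near.
exists d^-1; first by rewrite invr_ge0 ltW.
move=> x; have [->|x0] := eqVneq x 0; first by rewrite h0 !normr0 mulr0.
have nx : 0 < `|x| by rewrite normr_gt0.
have t0 : 0 < d / `|x| by rewrite divr_gt0.
have := dP ((d / `|x|) *: x); rewrite hh// !(normrZ (d / `|x|)) (gtr0_norm t0).
rewrite divfK ?lt0r_neq0// => /(_ (lexx _)).
by rewrite mulrAC ler_pdivrMr// mul1r mulrC -ler_pdivlMr// mulrC.
Unshelve. all: by end_near. Qed.

(* Only [f] needs to be Lipschitz: [f (f^k (v + x))] is compared with
   [f (v + h^k x)]. *)
Lemma first_order_iter f h v (L rho K : R) :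
  0 <= L -> 0 < rho -> 0 <= K ->
  (forall x y, `|x - v| <= rho -> `|y - v| <= rho ->
     `|f x - f y| <= L * `|x - y|) ->
  (forall x, `|h x| <= K * `|x|) ->
  (forall e, 0 < e -> \forall x \near (0 : X),
     `|f (v + x) - (v + h x)| <= e * `|x|) ->
  forall k (e : R), 0 < e -> \forall x \near (0 : X),
     `|iter k f (v + x) - (v + iter k h x)| <= e * `|x|.
Proof.
move=> L0 rho0 K0 fL hK fh; elim=> [|k IH] e e0.
  by near=> x; rewrite /= subrr normr0 mulr_ge0// ltW.
have Kk0 : 0 <= K ^+ k by rewrite exprn_ge0.
(* [e1] is the error allowed at rank [k], amplified by [L]; [e2] is the error of [f] at [v + h^k x].
   Each contributes [e / 2], and [e1 <= 1] keeps the iterate in the Lipschitz ball. *)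
set e1 := Num.min 1 (e / (2 * (L + 1))).
set e2 := e / (2 * (K ^+ k + 1)).
have e10 : 0 < e1 by rewrite lt_min ltr01 divr_gt0// mulr_gt0// ltr_wpDl.
have e20 : 0 < e2 by rewrite divr_gt0// mulr_gt0// ltr_wpDl.
have Le1 : L * e1 <= e / 2.
  have : e1 <= e / (2 * (L + 1)) by rewrite ge_min lexx orbT.
  move=> /(ler_wpM2l L0) /le_trans; apply.
  have LL : L / (L + 1) <= 1 by rewrite ler_pdivrMr ?ltr_wpDl// mul1r lerDl.
  have -> : L * (e / (2 * (L + 1))) = e / 2 * (L / (L + 1)).
    by field; rewrite lt0r_neq0// ltr_wpDl.
  by rewrite ler_piMr// divr_ge0// ltW.
have Ke2 : e2 * K ^+ k <= e / 2.
  have KK : K ^+ k / (K ^+ k + 1) <= 1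
    by rewrite ler_pdivrMr ?ltr_wpDl// mul1r lerDl.
  have -> : e2 * K ^+ k = e / 2 * (K ^+ k / (K ^+ k + 1)).
    by rewrite /e2; field; rewrite lt0r_neq0// ltr_wpDl.
  by rewrite ler_piMr// divr_ge0// ltW.
have [d d0 dP] := near0_norm_leP _ (fh e2 e20).
have [d1 d10 d1P] := near0_norm_leP _ (IH e1 e10).
have Kk1 : 0 < K ^+ k + 1 by rewrite ltr_wpDl.
near=> x.
have x1 : `|x| <= d1 by near: x; exact: near0_norm_le.
have x2 : `|x| <= Num.min d rho / (K ^+ k + 1).
  by near: x; apply: near0_norm_le; rewrite divr_gt0// lt_min d0.
rewrite ler_pdivlMr// le_min in x2; case/andP: x2 => xd xr.
have hkx := iter_bound h K K0 hK k x.
have nx := normr_ge0 x.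
have hd : `|iter k h x| <= d by nra.
have hr : `|iter k h x| <= rho by nra.
have E1 := d1P _ x1.
have e11 : e1 <= 1 by rewrite ge_min lexx.
have fr : `|iter k f (v + x) - v| <= rho.
  have -> : iter k f (v + x) - v =
    (iter k f (v + x) - (v + iter k h x)) + iter k h x
      by rewrite opprD addrA subrK.
  by apply: le_trans (ler_normD _ _) _; nra.
have E2 := dP _ hd.
have E3 := fL (iter k f (v + x)) (v + iter k h x) fr.
rewrite [v + _ - v]addrAC subrr add0r in E3; have {}E3 := E3 hr.
rewrite /=.
have -> : f (iter k f (v + x)) - (v + h (iter k h x)) =
    (f (iter k f (v + x)) - f (v + iter k h x)) +
    (f (v + iter k h x) - (v + h (iter k h x))) by rewrite addrA subrK.
apply: le_trans (ler_normD _ _) _.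
have E4 := ler_wpM2l L0 E1.
have E5 := ler_wpM2l (ltW e20) hkx.
have E6 := ler_wpM2r nx Le1.
have E7 := ler_wpM2r nx Ke2.
by rewrite !mulrA in E4 E5; lra.
Unshelve. all: by end_near. Qed.

End first_order.

(** * The norm and Thompson's metric in a normal cone *)

Section normal_cones.
Context {R : realType} {X : normedModType R}.
Context (C : set X) (C_proper : proper_cone C).
Context (M : R) (M_ge0 : 0 <= M).
Context (C_bound : forall x y, C x -> C (y - x) -> `|x| <= M * `|y|).
Implicit Types (x y z v : X) (a b : R).

(** From [0 <= (1 + a) x - y <= a (x + y)], normality bounds the middle term, and [x - y] differs
    from it by [a x]. *)
Lemma thompson_within_norm a x y : 0 <= a ->
  thompson_within C (1 + a) x y -> `|x - y| <= a * ((M + 1) * (`|x| + `|y|)).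
Proof.
move=> a0 [xy yx].
have E : a *: (x + y) - ((1 + a) *: x - y) = (1 + a) *: y - x.
  rewrite !scalerDl !scale1r scalerDr opprB opprD (addrA y) (addrC (a *: x)).
  by rewrite -(addrA (a *: y)) (addrC (a *: x)) subrK addrA (addrC y).
have := C_bound _ (a *: (x + y)) xy; rewrite E => /(_ yx).
rewrite normrZ ger0_norm// => le1.
have -> : x - y = ((1 + a) *: x - y) - a *: x.
  by rewrite scalerDl scale1r addrAC addrK.
apply: le_trans (ler_normB _ _) _; rewrite normrZ ger0_norm//.
have := ler_normD x y; have := normr_ge0 x; have := normr_ge0 y; have :=
  normr_ge0 (x + y).
move=> n1 n2 n3 n4.
have h1 : M * (a * `|x + y|) <= M * (a * (`|x| + `|y|)) by rewrite !ler_wpM2l.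
have h2 : a * `|x| <= a * (`|x| + `|y|) by rewrite ler_wpM2l// lerDl.
lra.
Qed.

(** The converse comparison. The factor [a] makes [a^-1 (x - y)] of norm [r / 2], so adding it to a
    point within [r / 2] of [v] does not leave the ball contained in [C]. *)
Lemma ball_thompson_within v r x y : 0 < r ->
  (forall z, `|z| <= r -> C (v + z)) ->
  `|x - v| <= r / 2 -> `|y - v| <= r / 2 ->
  thompson_within C (1 + 2 / r * `|x - y|) x y.
Proof.
move=> r0 Cr xv yv; have [<-|xy] := eqVneq x y.
  by rewrite subrr normr0 mulr0 addr0; exact: thompson_within_refl.
have nxy : 0 < `|x - y| by rewrite normr_gt0 subr_eq0.
set a := 2 / r * _; have a0 : 0 < a by rewrite mulr_gt0// divr_gt0.
have aux z z' : `|z - v| <= r / 2 -> `|z - z'| = `|x - y| -> C ((1 + a) *: z -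
  z').
  move=> zv zz'.
  have -> : (1 + a) *: z - z' = a *: (v + ((z - v) + a^-1 *: (z - z'))).
    rewrite addrCA addrA subrK scalerDr scalerA mulfV ?lt0r_neq0// scale1r.
    by rewrite scalerDl scale1r (addrC z) addrA.
  apply: (coneZ C C_proper); first exact: ltW.
  apply: Cr; apply: le_trans (ler_normD _ _) _.
  rewrite normrZ gtr0_norm ?invr_gt0// zz'.
  have -> : a^-1 * `|x - y| = r / 2.
    by rewrite /a; field; rewrite (lt0r_neq0 r0) (lt0r_neq0 nxy).
  by lra.
by split; apply: aux => //; rewrite distrC.
Qed.

Lemma thompson_within_near v e : C° v -> 0 < e ->
  \forall x \near v, thompson_within C (1 + e) v x.
Proof.
move=> Cv e0; have [r r0 Cr] := interior_closed_ball C v Cv.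
have d0 : 0 < Num.min (r / 2) (e * r / 2).
  by rewrite lt_min !divr_gt0// mulr_gt0.
apply/nbhs_normP; exists (Num.min (r / 2) (e * r / 2)) => // x /=.
rewrite lt_min => /andP[/ltW vx /ltW vx'].
have Cx : C x by rewrite -(subrKC v x); apply: Cr; rewrite distrC; lra.
apply: (thompson_within_le C C_proper (1 + 2 / r * `|v - x|)) => //.
- exact: interior_cone.
- by rewrite lerD2l mulrAC ler_pdivrMr//; lra.
- apply: (ball_thompson_within v r) => //; last by rewrite distrC.
  by rewrite subrr normr0 divr_ge0// ltW.
Qed.

(** For [e <= 1], the inequality [x <= 2 v] bounds the norm of [x] by [2 M |v|], which makes the
    constant of [thompson_within_norm] uniform in [x]. *)
Lemma thompson_within_close v d : 0 < d ->
  exists2 e, 0 < e & forall x, C x -> thompson_within C (1 + e) x v -> `|x - v|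
    <= d.
Proof.
move=> d0; have nv := normr_ge0 v.
set D := (M + 1) * ((2 * M + 1) * `|v|) + 1.
have D0 : 0 < D by rewrite ltr_wpDl// !mulr_ge0// addr_ge0// mulr_ge0.
exists (Num.min 1 (d / D)); first by rewrite lt_min ltr01 divr_gt0.
set e := Num.min _ _ => x Cx xv.
have e0 : 0 < e by rewrite lt_min ltr01 divr_gt0.
have e1 : e <= 1 by rewrite ge_min lexx.
have eD : e * D <= d by rewrite -ler_pdivlMr// ge_min lexx orbT.
apply: le_trans (thompson_within_norm _ _ _ (ltW e0) xv) _.
apply: le_trans eD; rewrite ler_pM2l//.
have : `|x| <= M * `|(1 + e) *: v| by apply: C_bound => //; case: xv.
rewrite normrZ gtr0_norm ?addr_gt0// => xM.
have : M * ((1 + e) * `|v|) <= M * (2 * `|v|).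
  by rewrite ler_wpM2l// ler_wpM2r//; lra.
move=> h; rewrite /D.
have : (M + 1) * (`|x| + `|v|) <= (M + 1) * ((2 * M + 1) * `|v|).
  by rewrite ler_wpM2l ?addr_ge0//; lra.
lra.
Qed.

End normal_cones.

Lemma normal_cone_bound {R : realType} {X : normedModType R} (C : set X) :
  normal_cone C ->
  exists2 M : R, 0 <= M & forall x y, C x -> C (y - x) -> `|x| <= M * `|y|.
Proof.
move=> [_ [M CM]]; exists (Num.max 0 M); first by rewrite le_max lexx.
move=> x y Cx Cyx; apply: le_trans (CM x y _ Cyx) _.
  by rewrite /cone_le subr0.
by rewrite ler_wpM2r// le_max lexx orbT.
Qed.

(** A ball of radius [r] around [v] inside [C] gives the upper constant [r^-1]; normality applied to
    [0 <= x + a v <= 2 a v] gives the lower one. *)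
Lemma cone_norm_equiv {R : realType} {X : normedModType R} (C : set X) (v : X) :
  normal_cone C -> C° v ->
  exists c1 c2 : R, 0 < c1 /\
    forall x, c1 * `|x| <= cone_norm C v x <= c2 * `|x|.
Proof.
move=> C_normal Cv; have [C_proper _] := C_normal.
have [M M0 CM] := normal_cone_bound C C_normal.
have [r r0 Cr] := interior_closed_ball C v Cv.
set D := (2 * M + 1) * `|v| + 1.
have D0 : 0 < D by rewrite ltr_wpDl// mulr_ge0// addr_ge0// mulr_ge0.
have mem x a : 0 < a -> `|x| <= r * a ->
    [set a : R | [/\ 0 < a, cone_le C (- a *: v) x & cone_le C x (a *: v)]] a.
  move=> a0 xa.
  have aux z : `|z| = `|x| -> C (a *: v + z).
    move=> zx; have -> : a *: v + z = a *: (v + a^-1 *: z).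
      by rewrite scalerDr scalerA mulfV ?scale1r// lt0r_neq0.
    apply: (coneZ C C_proper); first exact: ltW.
    apply: Cr; rewrite normrZ gtr0_norm ?invr_gt0// zx.
    by rewrite mulrC ler_pdivrMr.
  split=> //; rewrite /cone_le; last by apply: aux; rewrite normrN.
  by rewrite scaleNr opprK addrC; exact: aux.
have lb x a : [set a : R | [/\ 0 < a, cone_le C (- a *: v) x & cone_le C x (a
  *: v)]] a ->
    D^-1 * `|x| <= a.
  move=> [a0]; rewrite /cone_le scaleNr opprK => xa ax.
  have := CM (x + a *: v) ((2 * a) *: v) xa.
  have -> : (2 * a) *: v - (x + a *: v) = a *: v - x.
    by rewrite mulr_natl mulr2n scalerDl opprD (addrC (- x)) addrA addrK.
  move=> /(_ ax); rewrite normrZ gtr0_norm ?mulr_gt0// => h.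
  have h2 : `|x| <= `|x + a *: v| + `|a *: v|.
    by rewrite -{1}(addrK (a *: v) x) ler_normB.
  rewrite normrZ gtr0_norm// in h2.
  rewrite mulrC ler_pdivrMr// /D; lra.
exists D^-1, r^-1; split; first by rewrite invr_gt0.
move=> x; apply/andP; split.
  apply: lb_le_inf; last by move=> a; exact: lb.
  exists (`|x| / r + 1); apply: mem; first by rewrite ltr_wpDl// divr_ge0// ltW.
  by rewrite mulrDr mulrC divfK ?lt0r_neq0// lerDl mulr1 ltW.
(* The slack [e] keeps the candidate for the infimum positive even when [x = 0]. *)
apply/ler_addgt0Pr => e e0; apply: ge_inf.
  by exists (D^-1 * `|x|) => a; exact: lb.
have rx : 0 <= r^-1 * `|x| by rewrite mulr_ge0// invr_ge0 ltW.
apply: mem; first by rewrite ltr_wpDl.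
by rewrite mulrDr mulrA mulfV ?lt0r_neq0// mul1r lerDl mulr_ge0 ?ltW.
Qed.

Lemma limn_esup_le_near {R : realType} (u : (\bar R)^nat) (l : \bar R) :
  (\forall n \near \oo, (u n <= l)%E) -> (limn_esup u <= l)%E.
Proof.
move=> ul; rewrite /limn_esup limf_esupE.
apply: (@le_trans _ _ (ereal_sup (u @` [set n | (u n <= l)%E]))).
  by apply: ereal_inf_lbound; exists [set n | (u n <= l)%E].
by apply: ge_ereal_sup => _ [n /= h <-].
Qed.

(** * The basin of attraction of the fixed point *)

Section basin.
Context {R : realType} {X : normedModType R}.
Context (C G : set X) (f h : X -> X) (v : X).
Context (C_proper : proper_cone C) (M : R) (M_ge0 : 0 <= M).
Context (C_bound : forall x y, C x -> C (y - x) -> `|x| <= M * `|y|).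
Context (G_open : open G) (GC : G `<=` C) (fG : set_fun G G f).
Context (f_nonexp : forall x y, G x -> G y -> thompson C (f x) (f y) <=
  thompson C x y).
Context (Gv : G v) (fv : f v = v).
Context (K : R) (K_ge0 : 0 <= K) (hK : forall x, `|h x| <= K * `|x|).
Context (f_semidiff : forall e, 0 < e -> \forall x \near (0 : X),
     `|f (v + x) - (v + h x)| <= e * `|x|).
Context (r : R) (r_ge0 : 0 <= r) (r_lt1 : r < 1).
Context (h_radius : forall c, r < c -> \forall k \near \oo, forall x,
  `|iter k h x| <= c ^+ k * `|x|).
Implicit Types (x y w : X) (b c e : R) (n : nat).

Lemma open_sub_interior : G `<=` C°.
Proof. by rewrite -open_subsetE. Qed.

Lemma iter_set_fun n x : G x -> G (iter n f x).
Proof. by move=> Gx; elim: n => //= n; exact: fG. Qed.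

Lemma iter_fixed n w : f w = w -> iter n f w = w.
Proof. by move=> fw; elim: n => //= n ->. Qed.

Lemma iter_within n b x y : G x -> G y -> 1 <= b ->
  thompson_within C b x y -> thompson_within C b (iter n f x) (iter n f y).
Proof.
move=> Gx Gy b1 xy; elim: n => //= n /thompson_leP IH.
have Gxn := iter_set_fun n x Gx; have Gyn := iter_set_fun n y Gy.
apply/thompson_leP => //; try by apply: open_sub_interior; exact: fG.
by apply: le_trans (f_nonexp _ _ Gxn Gyn) _; apply: IH => //; exact:
  open_sub_interior.
Qed.

(** Near [v] the norm controls Thompson's metric, [f] does not increase the latter, and normality
    leads back to the norm because the images stay bounded. *)
Lemma fixed_locally_lipschitz : exists L rho : R, [/\ 0 <= L, 0 < rho,
  (forall x, `|x - v| <= rho -> G x) & forall x y, `|x - v| <= rho -> `|y - v|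
    <= rho ->
     `|f x - f y| <= L * `|x - y|].
Proof.
have [s s0 Cs] := interior_closed_ball C v (open_sub_interior _ Gv).
have [t t0 Gt] : exists2 t, 0 < t & forall z, `|z| <= t -> G (v + z).
  by apply: interior_closed_ball; rewrite (proj1 (interior_id _)).
pose rho := Num.min t (s / 2).
have rho0 : 0 < rho by rewrite lt_min t0 divr_gt0.
have rhoG x : `|x - v| <= rho -> G x.
  rewrite le_min => /andP[xt _]; rewrite -(subrKC v x); exact: Gt.
have rhos x : `|x - v| <= rho -> `|x - v| <= s / 2.
  by rewrite le_min => /andP[].
(* [x] is within a factor 2 of [v], hence so is [f x], as [f v = v]; normality turns [f x <= 2 v]
   into a norm bound. *)
have fbound x : `|x - v| <= rho -> `|f x| <= M * (2 * `|v|).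
  move=> xr; have xv : thompson_within C 2 x v.
    apply: (thompson_within_le C C_proper (1 + 2 / s * `|x - v|)).
    - exact/GC/rhoG.
    - exact: GC.
    - rewrite mulrAC; have : 2 * `|x - v| / s <= 1
      by rewrite ler_pdivrMr//; have := rhos _ xr; lra.
      by lra.
    - apply: (ball_thompson_within C C_proper v) => //; first exact: rhos.
      by rewrite subrr normr0 divr_ge0// ltW.
  have [_] := iter_within 1 2 x v (rhoG _ xr) Gv (ler1n _ 2) xv; rewrite /= fv
    => fxv.
  have := C_bound _ _ (GC _ (fG _ (rhoG _ xr))) fxv.
  by rewrite normrZ gtr0_norm.
exists (2 / s * ((M + 1) * (M * (2 * `|v|) + M * (2 * `|v|)))), rho; split=> //.
  have s2 : 0 <= 2 / s by rewrite divr_ge0// ltW.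
  by rewrite mulr_ge0// mulr_ge0 ?addr_ge0 ?mulr_ge0.
move=> x y xr yr.
have xy := ball_thompson_within C C_proper v s x y s0 Cs (rhos _ xr) (rhos _
  yr).
have a0 : 0 <= 2 / s * `|x - y| by rewrite mulr_ge0// divr_ge0// ltW.
have fxy := iter_within 1 _ x y (rhoG _ xr) (rhoG _ yr) _ xy.
apply: le_trans (thompson_within_norm C M M_ge0 C_bound _ _ _ a0 (fxy _)) _.
  by rewrite lerDl.
rewrite -[leRHS]mulrAC ler_wpM2l// ler_wpM2l ?addr_ge0//.
by rewrite lerD// fbound.
Qed.

Lemma local_convergence c : r < c -> c < 1 ->
  exists d b : R, [/\ 0 < d, 0 <= b, (forall x, `|x - v| <= d -> G x) &
    forall x, `|x - v| <= d -> forall n,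
      thompson_within C (1 + b * c ^+ n) (iter n f x) v].
Proof.
move=> rc c1.
have [L [rho [L0 rho0 rhoG fL]]] := fixed_locally_lipschitz.
have [s s0 Cs] := interior_closed_ball C v (open_sub_interior _ Gv).
set a := (r + c) / 2.
have [ra ac] : r < a /\ a < c by rewrite /a; split; lra.
have a0 : 0 < a by exact: le_lt_trans ra.
have c0 : 0 < c by exact: lt_trans ac.
have [m m0 hm] : exists2 m, (0 < m)%N & forall x, `|iter m h x| <= a ^+ m *
  `|x|.
  have ha := h_radius a ra.
  near \oo => m; exists m; first by near: m; exact: nbhs_infty_gt.
  by near: m.
(* The gap between [a ^+ m] and [c ^+ m] pays for the first-order error of [f^m], leaving a
   contraction by [c ^+ m] towards [v]. *)
have e0 : 0 < c ^+ m - a ^+ m by rewrite subr_gt0 ltr_pXn2r // nnegrE ltW.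
have := first_order_iter f h v L rho K L0 rho0 K_ge0 fL hK f_semidiff m _ e0.
move=> /near0_norm_leP[t t0 ft].
set d := Num.min rho (Num.min t (s / 2)).
have d0 : 0 < d by rewrite !lt_min rho0 t0 divr_gt0.
have contract x : `|x - v| <= d -> `|iter m f x - v| <= c ^+ m * `|x - v|.
  rewrite !le_min => /and3P[_ xt _]; have := ft _ xt; rewrite subrKC => h1.
  have h2 := hm (x - v).
  have -> : iter m f x - v = (iter m f x - (v + iter m h (x - v))) + iter m h
    (x - v).
    by rewrite opprD addrA subrK.
  apply: le_trans (ler_normD _ _) _; lra.
have cm0 : 0 <= c ^+ m by rewrite exprn_ge0// ltW.
have cm1 : c ^+ m <= 1 by rewrite exprn_ile1// ltW.
have contractX q x : `|x - v| <= d -> `|iter (q * m) f x - v| <= (c ^+ m) ^+ q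
  * `|x - v|.
  move=> xd; elim: q => [|q IH]; first by rewrite expr0 mul1r.
  rewrite mulSn iterD exprS -mulrA.
  have h1 : (c ^+ m) ^+ q <= 1 by rewrite exprn_ile1.
  have h2 : `|iter (q * m) f x - v| <= d.
    by apply: le_trans IH _; apply: le_trans xd; rewrite ler_piMl.
  by apply: le_trans (contract _ h2) _; rewrite ler_wpM2l.
have b0 : 0 <= 2 / s * (d / c ^+ m).
  by rewrite mulr_ge0// divr_ge0// ltW.
(* [2 / s] converts the norm into a factor. Dividing by [c ^+ m] makes up for the [n %% m] last
   iterations, which are only known not to move away from [v]. *)
exists d, (2 / s * (d / c ^+ m)); split=> //.
  by move=> x; rewrite le_min => /andP[+ _]; exact: rhoG.
move=> x xd n.
set y := iter (n %/ m * m) f x.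
have h1 := contractX (n %/ m)%N x xd; rewrite -/y in h1.
have cq1 : (c ^+ m) ^+ (n %/ m) <= 1 by rewrite exprn_ile1.
have yd : `|y - v| <= d.
  by apply: le_trans h1 _; apply: le_trans xd; rewrite ler_piMl.
have ds : d <= s / 2 by rewrite !ge_min lexx !orbT.
have Gy : G y by apply: rhoG; apply: le_trans yd _; rewrite ge_min lexx.
have yv : thompson_within C (1 + 2 / s * `|y - v|) y v.
  apply: (ball_thompson_within C C_proper v) => //; first exact: le_trans ds.
  by rewrite subrr normr0 divr_ge0// ltW.
have := iter_within (n %% m) _ _ _ Gy Gv _ yv; rewrite (iter_fixed _ v fv).
rewrite -iterD addnC -divn_eq => nv.
have yn : `|y - v| <= d / c ^+ m * c ^+ n.
  apply: le_trans h1 _; rewrite mulrAC ler_pdivlMr ?exprn_gt0// mulrAC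
    [leRHS]mulrC.
  apply: ler_pM => //; first by rewrite !mulr_ge0// exprn_ge0.
  rewrite -exprM -exprD ler_wiXn2l// ?(ltW c0) ?(ltW c1)//.
  by rewrite mulnC {1}(divn_eq n m) leq_add2l ltnW// ltn_mod.
have s20 : 0 <= 2 / s by rewrite divr_ge0// ltW.
apply: (thompson_within_le C C_proper (1 + 2 / s * `|y - v|)).
- by apply/GC/iter_set_fun/rhoG; apply: le_trans xd _; rewrite ge_min lexx.
- exact: GC.
- by rewrite lerD2l -[leRHS]mulrA ler_wpM2l.
- by apply: nv; rewrite lerDl mulr_ge0.
Unshelve. all: by end_near. Qed.

(** One time [n] for each [e] is enough: nonexpansiveness and [f v = v] keep all later iterates as
    close. *)
Definition basin : set X := [set x | G x /\
  forall e, 0 < e -> exists n, thompson_within C (1 + e) (iter n f x) v].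

Lemma basin_nbhs : exists2 d : R, 0 < d & forall x, `|x - v| <= d -> basin x.
Proof.
have r1 := r_lt1.
have [rc c1] : r < (r + 1) / 2 /\ (r + 1) / 2 < 1 by split; lra.
have [d [b [d0 b0 dG db]]] := local_convergence _ rc c1.
have c0 : 0 < (r + 1) / 2 by exact: le_lt_trans rc.
exists d => // x xd; split; first exact: dG.
(* Constant [b / e] and larger rate 1 make the error term of [local_convergence] at most [e]. *)
move=> e e0; have small := geometric_dominated (b / e) _ _ c0 c1.
near \oo => n; exists n; apply: (thompson_within_le C C_proper) (db x xd n).
- exact/GC/iter_set_fun/dG.
- exact: GC.
- rewrite lerD2l; have : b / e * ((r + 1) / 2) ^+ n <= 1 ^+ n
  by near: n; exact: small.
  by rewrite expr1n mulrAC ler_pdivrMr// mul1r.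
Unshelve. all: by end_near. Qed.

Lemma basin_iter n x : G x -> basin (iter n f x) -> basin x.
Proof.
move=> Gx [_ bx]; split=> // e /bx[k]; rewrite -iterD => xk.
by exists (k + n)%N.
Qed.

(** When [f^n y] is near [v], so is [f^n x], which then lies in the ball of [basin_nbhs]. That [e]
    does not depend on [y] is what makes the basin closed in [G] as well as open. *)
Lemma basin_within : exists2 e : R, 0 < e & forall x y, G x -> basin y ->
  thompson_within C (1 + e) x y -> basin x.
Proof.
have [d d0 dA] := basin_nbhs.
have [e e0 ed] := thompson_within_close C M M_ge0 C_bound v d d0.
(* As [e' <= 1], one has [(1 + e')^2 <= 1 + 3 e' <= 1 + e]. *)
pose e' := Num.min 1 (e / 3).
have e'0 : 0 < e' by rewrite lt_min ltr01 divr_gt0.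
have [e'1 e'e] : e' <= 1 /\ e' <= e / 3 by rewrite !ge_min lexx lexx orbT.
exists e' => // x y Gx [Gy yA] xy.
have [n yv] := yA e' e'0.
have xyn : thompson_within C (1 + e') (iter n f x) (iter n f y).
  by apply: iter_within => //; rewrite lerDl ltW.
have e1 : 0 <= 1 + e' by rewrite addr_ge0// ltW.
have xv := thompson_within_trans C C_proper _ _ _ _ _ e1 e1 xyn yv.
have Cx : C (iter n f x) by exact/GC/iter_set_fun.
apply: (basin_iter n) => //; apply/dA/ed => //.
by apply: (thompson_within_le C C_proper _ _ _ _ Cx (GC _ Gv) _ xv); nra.
Qed.

Lemma basin_connected : connected G -> basin = G.
Proof.
move=> Gconn; have [e e0 eA] := basin_within.
have near_within x : G x -> \forall y \near x, G y /\ thompson_within C (1 + e)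
  x y.
  move=> Gx; near=> y; split; near: y; first exact: open_nbhs_nbhs.
  by apply: thompson_within_near => //; exact: open_sub_interior.
apply: Gconn.
- have [d d0 dA] := basin_nbhs; exists v; apply: dA.
  by rewrite subrr normr0 ltW.
- exists basin; last by apply/seteqP; split=> [x [? ?]|x []].
  rewrite openE => x xA; have Gx := proj1 xA.
  apply: filterS (near_within x Gx) => y [Gy xy].
  by apply: eA xA _ => //; exact: thompson_withinC.
(* A point of [G] in the closure has a basin point within the uniform factor [1 + e], so it is
   itself in the basin. *)
- exists (closure basin); first exact: closed_closure.
  apply/seteqP; split=> [x xA|x [Gx xA]]; first
    by split; [case: xA|exact: subset_closure].
  by have [y [yA [_ xy]]] := xA _ (near_within x Gx); exact: eA yA xy.
Unshelve. all: by end_near. Qed.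

Lemma fixed_point_unique w : G w -> f w = w -> w = v.
Proof.
move=> Gw fw.
have [Cv Cw] : C° v /\ C° w by split; exact: open_sub_interior.
(* The least factor relating [v] and [w]; the contradiction will be a smaller one. *)
set b := expR (thompson C v w).
have b1 : 1 <= b by rewrite -expR0 ler_expR thompson_ge0.
have vw : thompson_within C b v w by apply/thompson_leP => //; rewrite expRK.
have bmin b' : 1 <= b' -> thompson_within C b' v w -> b <= b'.
  move=> b'1 /(thompson_leP C C_proper _ _ _ Cv Cw b'1) le_b'.
  by rewrite -(@lnK _ b') ?ler_expR// posrE (lt_le_trans ltr01).
have [b_eq1|b_neq1] := eqVneq b 1.
  rewrite b_eq1 in vw; case: vw; rewrite !scale1r => vw wv.
  apply/eqP; rewrite -subr_eq0; apply/eqP/(cone_pointed C C_proper) => //.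
  by rewrite opprB.
have {b_neq1} b_gt1 : 1 < b by rewrite lt_neqAle eq_sym b_neq1.
have [d d0 dA] := basin_nbhs.
(* The second bound puts [x] in the ball of [basin_nbhs]; the first gives [t * b <= 1], whence
   [1 - b' * t] is nonnegative below. *)
pose t := Num.min b^-1 (d / (`|w - v| + 1)).
have b0 : 0 < b by exact: lt_trans b_gt1.
have n0 : 0 < `|w - v| + 1 by rewrite ltr_wpDl.
have t0 : 0 < t by rewrite lt_min invr_gt0 b0 divr_gt0.
have tb : t * b <= 1 by rewrite -ler_pdivlMr// mul1r ge_min lexx.
have td : t * `|w - v| <= d.
  have : t * (`|w - v| + 1) <= d by rewrite -ler_pdivlMr// ge_min lexx orbT.
  by rewrite mulrDr mulr1; lra.
have t1 : t <= 1 by nra.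
set x := (1 - t) *: v + t *: w.
have xA : basin x.
  apply: dA; have -> : x - v = t *: (w - v).
    by rewrite /x scalerBl scale1r scalerBr addrAC (addrC v) addrK addrC.
  by rewrite normrZ gtr0_norm.
(* Chosen so that [b' w - x] is exactly [(1 - t) (b w - v)]. *)
pose b' := (1 - t) * b + t.
have b'1 : 1 <= b' by rewrite /b'; nra.
have b'b : b' < b by rewrite /b'; nra.
have xw : thompson_within C b' x w.
  case: vw => vw wv; split.
  (* Splitting off [b v - w] leaves on [v] the coefficient [t (1 - t) (b - 1)^2], which is
     nonnegative. *)
  - have -> : b' *: x - w = (1 - b' * t) *: (b *: v - w)
        + (b' * (1 - t) - (1 - b' * t) * b) *: v.
      rewrite /x scalerDr !scalerA scalerBr scalerA [RHS]addrAC -scalerDl.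
      rewrite [_ * b + _]addrC subrK scalerBl scale1r opprB.
      by rewrite addrA.
    apply: (coneD C C_proper); apply: (coneZ C C_proper) => //.
    + by nra.
    + have -> : b' * (1 - t) - (1 - b' * t) * b = t * (1 - t) * (b - 1) ^+ 2.
        by rewrite /b'; ring.
      by rewrite mulr_ge0 ?sqr_ge0// mulr_ge0 ?subr_ge0// ltW.
    + exact: GC.
  - have -> : b' *: w - x = (1 - t) *: (b *: w - v).
      by rewrite /x /b' scalerBr scalerA scalerDl opprD [- _ - _]addrC addrA
        addrK.
    by apply: (coneZ C C_proper) => //; lra.
(* At this closeness to [v], the composed factor between [v] and [w = f^n w] is [(b + b') / 2],
   still less than [b]. *)
have [Gx /(_ ((b - b') / (2 * b')))[|n xnv]] := xA.
  by rewrite divr_gt0// ?subr_gt0// mulr_gt0// (lt_le_trans ltr01).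
have xnw := iter_within n _ _ _ Gx Gw b'1 xw; rewrite (iter_fixed n w fw) in
  xnw.
have b'0 : 0 < b' by exact: lt_le_trans b'1.
have e0 : 0 <= 1 + (b - b') / (2 * b').
  by rewrite addr_ge0// divr_ge0// ?subr_ge0 ltW// mulr_gt0.
have := thompson_within_trans C C_proper _ _ _ _ _ e0 (ltW b'0)
  (thompson_withinC C _ _ _ xnv) xnw.
have -> : (1 + (b - b') / (2 * b')) * b' = (b + b') / 2.
  by field; rewrite lt0r_neq0.
have b''1 : 1 <= (b + b') / 2 by lra.
by move=> /(bmin _ b''1); rewrite leNgt => /negP[]; lra.
Qed.

(** Once [f^m x] is in the small ball, the distance at time [n] is at most
    [ln (1 + b c^(n - m)) <= (b / c^m) c^n], and a slightly larger rate [c'] absorbs the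
    constant. *)
Lemma basin_rate x : basin x ->
  (limn_esup (fun k => (thompson C (iter k f x) v `^ (k%:R^-1))%:E) <= r%:E)%E.
Proof.
move=> [Gx xA]; apply/lee_addgt0Pr => e e0; rewrite -EFinD.
have r1 := r_lt1.
(* The cap [(r + 1) / 2] keeps the rate below 1 for large [e], as [local_convergence] requires. *)
pose c' := Num.min (r + e) ((r + 1) / 2).
have rc' : r < c' by rewrite lt_min; apply/andP; split; lra.
have c're : c' <= r + e by rewrite ge_min lexx.
have c'1 : c' < 1.
  have : c' <= (r + 1) / 2 by rewrite ge_min lexx orbT.
  by lra.
apply: (@le_trans _ _ c'%:E); last by rewrite lee_fin.
pose c := (r + c') / 2.
have [rc cc'] : r < c /\ c < c' by rewrite /c; split; lra.
have c0 : 0 < c by exact: le_lt_trans rc.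
have [d [b [d0 b0 dG db]]] := local_convergence c rc (lt_trans cc' c'1).
have [e1 e10 ed] := thompson_within_close C M M_ge0 C_bound v d d0.
have [m xm] := xA e1 e10.
have xd : `|iter m f x - v| <= d by apply: ed => //; exact/GC/iter_set_fun.
have small := geometric_dominated (b / c ^+ m) _ _ c0 cc'.
apply: limn_esup_le_near; near=> n; rewrite lee_fin.
have n0 : (0 < n)%N by near: n; exact: nbhs_infty_gt.
have mn : (m <= n)%N by near: n; exact: nbhs_infty_ge.
have Cn : C° (iter n f x) by exact/open_sub_interior/iter_set_fun.
have Cv := open_sub_interior _ Gv.
apply/powR_inv_le => //; first exact: thompson_ge0.
  by rewrite ltW// (le_lt_trans r_ge0).
have := db _ xd (n - m)%N; rewrite -iterD subnK// => nv.
have bc0 : 0 <= b * c ^+ (n - m) by rewrite mulr_ge0// exprn_ge0// ltW.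
have := (thompson_leP C C_proper _ _ _ Cn Cv _).2 nv.
rewrite lerDl => /(_ bc0) le1.
apply: le_trans le1 _; apply: le_trans (le_ln1Dx _) _; first by lra.
have : b / c ^+ m * c ^+ n <= c' ^+ n by near: n; exact: small.
apply: le_trans; rewrite -mulrA ler_wpM2l//.
by rewrite -{2}(subnK mn) exprD mulrC mulrK// unitfE lt0r_neq0// exprn_gt0.
Unshelve. all: by end_near. Qed.

End basin.

(** * Both conclusions, for either choice of norm *)

Theorem theorem7p2 (R : realType) (X : completeNormedModType R)
    (C G : set X) (f : X -> X) (v : X) (h : X -> X) (N : X -> R)
    (C_normal : normal_cone C) (C_int : C° !=set0)
    (G_open : open G) (GC : G `<=` C)
    (fG : set_fun G G f)
    (f_nonexp : forall x y, G x -> G y ->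
       thompson C (f x) (f y) <= thompson C x y)
    (Gv : G v) (fv : f v = v)
    (f_semidiff : is_semidiff G f v h)
    (N_choice : N = (fun x => `|x|) \/ N = cone_norm C v)
    (radius_lt1 : bonsall_radius N h < 1) :
  (forall w, G w -> f w = w -> w = v) /\
  (connected G -> forall x, G x ->
     (limn_esup (fun k => (thompson C (iter k f x) v `^ (k%:R^-1))%:E)
        <= (bonsall_radius N h)%:E)%E).
Proof.
have C_proper := proj1 C_normal.
have [M M0 CM] := normal_cone_bound C C_normal.
have Cv : C° v by exact: (open_sub_interior C G).
have [_ hc hh fo] := f_semidiff.
have [K K0 hK] := pos_homogeneous_bound h hc hh.
have fh e : 0 < e -> \forall x \near (0 : X),
    `|f (v + x) - (v + h x)| <= e * `|x|.
  by move=> e0; move/eqoP: fo => /(_ e e0); rewrite fv.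
have [c1 [c2 [c10 N_equiv]]] : exists c1 c2 : R, 0 < c1 /\
    forall x, c1 * `|x| <= N x <= c2 * `|x|.
  case: N_choice => ->; last exact: cone_norm_equiv.
  by exists 1, 1; split=> // x; rewrite mul1r lexx.
have r0 := bonsall_radius_ge0 N c1 c2 c10 N_equiv h K K0 hK.
have hr := bonsall_radius_iter N c1 c2 c10 N_equiv h K K0 hK.
split=> [w Gw fw|G_conn x Gx].
  exact: (fixed_point_unique C G f h v C_proper M M0 CM G_open GC fG f_nonexp
    Gv fv K K0 hK fh _ r0 radius_lt1 hr).
apply: (basin_rate C G f h v C_proper M M0 CM G_open GC fG f_nonexp
  Gv fv K K0 hK fh _ r0 radius_lt1 hr).
by rewrite (basin_connected C G f h v C_proper M M0 CM G_open GC fG f_nonexp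
  Gv fv K K0 hK fh _ r0 radius_lt1 hr).
Qed.
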